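(* Let $s$ be a string of length $n$ and let $z$ be the number of phrases in the (non-self-referencing) LZ77 parse of $s$. The block graph for $s$ takes $O(z \log^2 n)$ bits.
   Context: LZ77 parse (without self-referencing): $s$ is split from left to right into phrases; if the next phrase starts at position $i$, it is the longest prefix of $s[i..n]$ that has an occurrence lying entirely inside $s[1..i-1]$, or the single character $s[i]$ if that character does not occur in $s[1..i-1]$. $z$ is the number of phrases. Block graph: pad $s$ with blanks to length $N = 2^{\lceil \log_2 n\rceil}$. Nodes are intervals $\langle i..j\rangle$, associated with the block $s[i..j]$. The root $\langle 1..N\rangle$ has depth $0$. A node $\langle i..i+b-1\rangle$ at depth $d$ (block size $b = N/2^d$) has three children at depth $d+1$: $\langle i..i+b/2-1\rangle$, $\langle i+b/4..i+3b/4-1\rangle$ and $\langle i+b/2..i+b-1\rangle$ (adjacent nodes share a child; a node may have two parents). Nodes whose blocks contain only blanks, or only blanks and characters lying in another block at the same depth, are removed, and any node $\langle i..j\rangle$ with $j>n$ is replaced by $\langle i..n\rangle$. A node is internal if its block is the first (leftmost) occurrence of that substring in $s$; a node is a leaf if its block is not the first occurrence of its substring and its parent is internal; all other nodes are removed. The graph is truncated at a depth where storing a block explicitly costs no more than storing three pointers: internal nodes at that deepest depth store their blocks explicitly. For each leaf $u$ at depth $d$ and each of its (removed) would-be children $\langle i..j\rangle$, with first occurrence $s[i'..j']$ of $s[i..j]$, $u$ stores a pointer to the internal node at depth $d$ whose block contains $s[i'..j']$, together with the offset of $i'$ in that block. Each node stores $O(\log n)$ bits. *)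

(* Defs.v *)
From mathcomp Require Import all_boot.

Set Implicit Arguments.
Unset Strict Implicit.
Unset Printing Implicit Defensive.

(* Positions are 0-based: s[i..j] in 1-based inclusive notation is
   take (j - i).+1 (drop i.-1 s). *)

Section LZ77.
Variables (A : eqType) (s : seq A).

(* The maximum is 0 exactly when the character at position i does not occur
   in the prefix of length i; the phrase is then that single character. *)
Definition lz_len (i : nat) : nat :=
  maxn 1 (\max_(l < (size s - i).+1 | infix (take l (drop i s)) (take i s)) l).

(* Phrases have length at least 1, so size s is enough fuel. *)
Fixpoint lz_from (fuel i : nat) : seq (seq A) :=
  if fuel is k.+1 then
    if i < size s then take (lz_len i) (drop i s) :: lz_from k (i + lz_len i)
    else [::]
  else [::].

Definition lz77_parse : seq (seq A) := lz_from (size s) 0.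

Definition lz77_size : nat := size lz77_parse.

End LZ77.

(* The node (d, i) is the interval of depth d starting at position i. *)
Definition node := (nat * nat)%type.

Inductive node_data (A : Type) :=
  | ExplicitBlock of seq A
  | ChildPointers of seq node
  | CopyPointers of seq (node * nat).

Section BlockGraph.
Variables (A : eqType) (s : seq A).

Let n := size s.

Definition padded_length : nat := 2 ^ up_log 2 n.

Definition block_size (d : nat) : nat := padded_length %/ 2 ^ d.

Definition child_starts (d i : nat) : seq nat :=
  [:: i; i + block_size d %/ 4; i + block_size d %/ 2].

(* All starting positions at depth d, before any node is removed. *)
Fixpoint grid (d : nat) : seq nat :=
  if d is d'.+1 then undup (flatten [seq child_starts d' i | i <- grid d'])
  else [:: 0].

(* The part of the interval inside s, i.e. with every end j > n reset to n. *)
Definition block (u : node) : seq A := take (block_size u.1) (drop u.2 s).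

(* All non-blank characters of u lie in a single other interval of the same
   depth; intervals of equal length being incomparable, this only happens when
   u contains blanks. *)
Definition redundant (u : node) : bool :=
  has (fun i => [&& i != u.2, i <= u.2 &
                 minn (u.2 + block_size u.1) n <= i + block_size u.1])
      (grid u.1).

(* The nodes that survive the removal of blanks. *)
Definition kept (u : node) : bool :=
  [&& u.2 \in grid u.1, u.2 < n & ~~ redundant u].

(* The middle child of an interval of length 2 would start at a half-integer;
   rounding makes it a copy of the left child, which undup discards. *)
Definition children (u : node) : seq node :=
  [seq c <- [seq (u.1.+1, i) | i <- undup (child_starts u.1 u.2)] | kept c].

Definition first_occurrence (u : node) : bool := infix_index (block u) s == u.2.

Definition internal (u : node) : bool := kept u && first_occurrence u.

(* A node with two parents needs only one of them to be internal. *)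
Definition leaf (u : node) : bool :=
  [&& kept u, ~~ first_occurrence u, 0 < u.1 &
      has (fun i => internal (u.1.-1, i) && (u \in children (u.1.-1, i)))
          (grid u.1.-1)].

Definition in_graph (u : node) : bool := internal u || leaf u.

(* The block graph truncated at depth D. *)
Definition block_graph (D : nat) : seq node :=
  [seq u <- [seq (d, i) | d <- iota 0 D.+1, i <- grid d] | in_graph u].

(* An internal node of depth d whose block contains the first occurrence of
   the block of c, and the offset of that occurrence.  Such a node exists
   whenever c has depth d.+1, so the default is not used. *)
Definition copy_pointer (d : nat) (c : node) : node * nat :=
  let i' := infix_index (block c) s in
  let t := head 0 [seq i <- grid d | internal (d, i) &&
             (i <= i') && (i' + size (block c) <= i + size (block (d, i)))] in
  ((d, t), i' - t).

Definition stored_data (D : nat) (u : node) : node_data A :=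
  if internal u then
    if u.1 == D then ExplicitBlock (block u)
    else ChildPointers A [seq c <- children u | in_graph c]
  else CopyPointers A [seq copy_pointer u.1 c | c <- children u].

End BlockGraph.

(* Sizes in bits when a character takes cb bits, and a pointer and an offset
   take w bits each. *)
Definition data_bits (A : Type) (cb w : nat) (x : node_data A) : nat :=
  match x with
  | ExplicitBlock t => size t * cb
  | ChildPointers cs => size cs * w
  | CopyPointers ps => size ps * (w + w)
  end.

Definition char_bits (A : finType) : nat := up_log 2 #|A|.

(* The extra bit per node tells internal nodes from leaves. *)
Definition block_graph_bits (A : finType) (s : seq A) (w D : nat) : nat :=
  \sum_(u <- block_graph s D) (1 + data_bits (char_bits A) w (stored_data s D u)).

(* Depth D is an admissible truncation depth: its blocks still have at least
   two characters, and storing one explicitly costs no more than storing three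
   w-bit pointers. *)
Definition truncation_depth (A : finType) (s : seq A) (w D : nat) : bool :=
  (1 < block_size s D) && (block_size s D * char_bits A <= 3 * w).

(* Main.v *)
(** A substring whose first occurrence starts at [i] cannot lie inside a copied
LZ77 phrase that starts before [i], so it contains the start of a phrase.  At
each depth the intervals start at multiples of half the block size, hence at
most two of them cover a given phrase start: there are at most [2 z] internal
nodes per depth, and at most [6 z] leaves, every leaf being one of the three
children of an internal node.  With at most [up_log 2 n] usable depths and
[O(log n)] bits per node, the total is [O(z log^2 n)]. *)

Require Import Defs.
From mathcomp Require Import all_boot.
From mathcomp Require Import zify.

Set Implicit Arguments.
Unset Strict Implicit.
Unset Printing Implicit Defensive.

Lemma infix_index_cat (T : eqType) (t a b : seq T) :
  infix t a -> infix_index t (a ++ b) <= size a.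
Proof.
elim: a => [|x a IHa]; first by rewrite infixs0 => /eqP->; rewrite infix_index0s.
rewrite infix_consl => /orP[pre|/IHa le_a].
  by rewrite prefix_index // (prefix_trans pre) // prefix_prefix.
by rewrite cat_cons /=; case: ifP.
Qed.

Lemma sum_nat_const_seq (I : Type) (r : seq I) (k : nat) :
  \sum_(i <- r) k = size r * k.
Proof. by rewrite big_const_seq count_predT iter_addn_0 mulnC. Qed.

Lemma size_flatten_map_const (S T : Type) (f : S -> seq T) (k : nat) (r : seq S) :
  (forall x, size (f x) = k) -> size (flatten (map f r)) = k * size r.
Proof.
move=> size_f; elim: r => [|x r IHr] /=; first by rewrite muln0.
by rewrite size_cat size_f IHr mulnS.
Qed.

Lemma up_log2_leq_double_trunc_log n :
  1 < n -> up_log 2 n <= 2 * trunc_log 2 n.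
Proof.
move=> n_gt1; have t_gt0 : 0 < trunc_log 2 n by rewrite trunc_log_gt0.
apply: (@leq_trans (trunc_log 2 n).+1); last by lia.
by apply: up_log_min => //; apply/ltnW/trunc_log_ltn.
Qed.

Section PhraseStarts.
Variables (A : eqType) (s : seq A).

Fixpoint phrase_starts_from (fuel i : nat) : seq nat :=
  if fuel is k.+1 then
    if i < size s then i :: phrase_starts_from k (i + lz_len s i) else [::]
  else [::].

Definition phrase_starts : seq nat := phrase_starts_from (size s) 0.

Lemma size_phrase_starts : size phrase_starts = lz77_size s.
Proof.
rewrite /phrase_starts /lz77_size /lz77_parse.
by elim: (size s) 0 => //= k IHk i; case: ifP => //= _; rewrite IHk.
Qed.

Lemma lz_len_gt0 i : 0 < lz_len s i.
Proof. by rewrite /lz_len leq_max. Qed.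

Lemma lz_phrase_occurs_before i :
  1 < lz_len s i -> infix (take (lz_len s i) (drop i s)) (take i s).
Proof.
pose P (l : 'I_(size s - i).+1) := infix (take l (drop i s)) (take i s).
have P0 : P ord0 by rewrite /P take0 infix0s.
rewrite /lz_len (bigmax_eq_arg ord0 P0); case: arg_maxnP => // l Pl _ l_gt1.
by have -> : maxn 1 l = l by lia.
Qed.

Lemma infix_index_in_phrase i j b :
  i < j < i + lz_len s i ->
  (j + b <= i + lz_len s i) || (size s <= i + lz_len s i) ->
  infix_index (take b (drop j s)) s <= i.
Proof.
set l := lz_len s i => /andP[lt_ij lt_jl] long.
have /lz_phrase_occurs_before occ : 1 < lz_len s i by rewrite -/l; lia.
have sub : infix (take b (drop j s)) (take l (drop i s)).
  have -> : l = (j - i) + (l - (j - i)) by lia.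
  rewrite takeD drop_drop subnK ?(ltnW lt_ij) //.
  apply/infix_catl/prefixW; case/orP: long => long.
    have le_b : b <= l - (j - i) by lia.
    by rewrite -(take_takel _ le_b) prefix_take.
  by rewrite [X in prefix _ X]take_oversize ?prefix_take // size_drop; lia.
have := infix_index_cat (drop i s) (infix_trans sub occ).
by rewrite cat_take_drop size_take_min => /leq_trans; apply; lia.
Qed.

Lemma first_occurrence_meets_phrase_start_from k i j b :
  size s <= i + k -> i <= j < size s -> 0 < b ->
  infix_index (take b (drop j s)) s = j ->
  exists2 p, p \in phrase_starts_from k i & j <= p < j + b.
Proof.
move=> + + b_gt0 first_j; elim: k i => [|k IHk] i fuel /andP[le_ij lt_js] /=; first by lia.
have l_gt0 := lz_len_gt0 i.
have -> : i < size s by lia.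
have [-> | ne_ij] := eqVneq i j; first by exists j; rewrite ?mem_head //; lia.
have [le_lj | lt_jl] := leqP (i + lz_len s i) j.
  have [||p p_in p_j] := IHk (i + lz_len s i); [lia | lia |].
  by exists p; rewrite // inE p_in orbT.
have [long|] := boolP ((j + b <= i + lz_len s i) || (size s <= i + lz_len s i)).
  have := @infix_index_in_phrase i j b; rewrite first_j; lia.
rewrite negb_or -!ltnNge => /andP[lt_lj lt_ls].
exists (i + lz_len s i); last by lia.
rewrite inE; apply/orP; right; case: k fuel {IHk} => [|k] fuel /=; first by lia.
by rewrite lt_ls mem_head.
Qed.

Lemma first_occurrence_meets_phrase_start j b :
  j < size s -> 0 < b -> infix_index (take b (drop j s)) s = j ->
  exists2 p, p \in phrase_starts & j <= p < j + b.
Proof.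
by move=> *; apply: first_occurrence_meets_phrase_start_from; rewrite ?add0n.
Qed.

End PhraseStarts.

Section NodesPerDepth.
Variables (A : eqType) (s : seq A).

Lemma block_sizeE d :
  d <= up_log 2 (size s) -> block_size s d = 2 ^ (up_log 2 (size s) - d).
Proof. by move=> le_d; rewrite /block_size /padded_length -expnB. Qed.

Lemma block_size_gt1 d : (1 < block_size s d) = (d < up_log 2 (size s)).
Proof.
have [lt_d | le_d] := ltnP d (up_log 2 (size s)).
  by rewrite block_sizeE ?(ltnW lt_d) // -[1]/(2 ^ 0) ltn_exp2l // subn_gt0.
apply/negbTE; rewrite -leqNgt /block_size /padded_length.
by rewrite (leq_trans (leq_div2r _ (leq_pexp2l _ le_d))) // divnn expn_gt0.
Qed.

Lemma grid_uniq d : uniq (grid s d).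
Proof. by case: d => //= d; apply: undup_uniq. Qed.

Lemma half_block_size_dvd_grid d i :
  d < up_log 2 (size s) -> i \in grid s d ->
  2 ^ (up_log 2 (size s) - d.+1) %| i.
Proof.
elim: d i => [|d IHd] i lt_d; first by rewrite inE => /eqP->; rewrite dvdn0.
rewrite /= mem_undup => /flatten_mapP[j /(IHd _ (ltnW lt_d)) dvd_j].
rewrite /child_starts block_sizeE; last by lia.
have [m L_d] : exists m, up_log 2 (size s) - d = m.+2.
  by exists (up_log 2 (size s) - d).-2; lia.
have -> : up_log 2 (size s) - d.+2 = m by lia.
rewrite L_d !expnS mulnA mulKn // -!mulnA mulKn //.
have {}dvd_j : 2 ^ m %| j.
  by apply: dvdn_trans dvd_j; apply: dvdn_exp2l; lia.
by rewrite !inE => /or3P[] /eqP->; rewrite ?dvdn_add // dvdn_mull.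
Qed.

Lemma count_internal d :
  d < up_log 2 (size s) ->
  count (fun i => internal s (d, i)) (grid s d) <= 2 * lz77_size s.
Proof.
move=> lt_d; set h := 2 ^ (up_log 2 (size s) - d.+1).
have h_gt0 : 0 < h by rewrite expn_gt0.
have bE : block_size s d = 2 * h.
  by rewrite block_sizeE ?(ltnW lt_d) // /h -expnS; congr (2 ^ _); lia.
pose f p := [:: p %/ h * h; (p %/ h).-1 * h].
rewrite -size_phrase_starts -(@size_flatten_map_const _ _ f) // -size_filter.
apply: uniq_leq_size; first by rewrite filter_uniq // grid_uniq.
move=> i; rewrite mem_filter => /andP[/andP[/and3P[_ /= lt_is _] /eqP/= first_i]].
move=> /(half_block_size_dvd_grid lt_d); rewrite -/h => /dvdnP[q def_i].
have [|p p_in] := first_occurrence_meets_phrase_start lt_is _ first_i.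
  by rewrite bE muln_gt0.
rewrite bE /= def_i => /andP[le_qp lt_pq].
apply/flatten_mapP; exists p => //; rewrite !inE !eqn_pmul2r //.
have: q <= p %/ h by rewrite leq_divRL.
have: p %/ h < q + 2 by rewrite ltn_divLR // mulnDl.
by lia.
Qed.

Lemma count_leaf d :
  d < up_log 2 (size s) ->
  count (fun i => leaf s (d, i)) (grid s d) <= 6 * lz77_size s.
Proof.
case: d => [|d] lt_d.
  by rewrite (@eq_count _ _ pred0) ?count_pred0 // => i; rewrite /leaf /= !andbF.
rewrite -[6]/(3 * 2) -mulnA.
apply: leq_trans (leq_mul (leqnn 3) (count_internal (ltnW lt_d))).
rewrite -!size_filter -(@size_flatten_map_const _ _ (child_starts s d)) //.
apply: uniq_leq_size; first by rewrite filter_uniq // grid_uniq.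
move=> i; rewrite mem_filter => /andP[/and4P[_ _ _]].
move=> /hasP[/= j j_in /andP[j_internal i_child] _].
move: i_child; rewrite mem_filter => /andP[_ /mapP[k]].
rewrite mem_undup => k_child [->].
by apply/flatten_mapP; exists j; rewrite // mem_filter j_internal.
Qed.

Lemma size_block_graph D :
  D < up_log 2 (size s) ->
  size (block_graph s D) <= 8 * lz77_size s * up_log 2 (size s).
Proof.
move=> lt_D; rewrite /block_graph size_filter count_flatten -map_comp sumnE big_map.
apply: leq_trans (leq_mul (leqnn _) lt_D).
rewrite -{2}(size_iota 0 D.+1) mulnC -sum_nat_const_seq big_seq [X in _ <= X]big_seq.
apply: leq_sum => d; rewrite mem_iota add0n ltnS => /andP[_ le_d] /=.
have {le_d}lt_d := leq_ltn_trans le_d lt_D.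
rewrite count_map; have := leq_add (count_internal lt_d) (count_leaf lt_d).
rewrite -mulnDl -count_predUI; apply: leq_trans; exact: leq_addr.
Qed.

Lemma size_children u : size (children s u) <= 3.
Proof.
rewrite /children size_filter (leq_trans (count_size _ _)) // size_map.
exact: size_undup.
Qed.

End NodesPerDepth.

Lemma stored_data_bits (A : finType) (s : seq A) (w D : nat) (u : node) :
  truncation_depth s w D ->
  data_bits (char_bits A) w (stored_data s D u) <= 6 * w.
Proof.
case/andP=> _ block_cost; have le3 := size_children s u.
rewrite /stored_data; case: ifP => _ /=; last first.
  by rewrite size_map addnn -mul2n mulnA leq_mul2r; lia.
case: eqP => [uD | _] /=.
  apply: leq_trans (leq_trans block_cost _); last by rewrite leq_mul2r orbT.
  by rewrite leq_mul2r /block size_take_min uD geq_minl orbT.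
rewrite leq_mul2r size_filter.
by rewrite (leq_trans (count_size _ _)) ?orbT // (leq_trans le3).
Qed.

Theorem theorem1 :
  forall c : nat, exists C : nat,
    forall (A : finType) (s : seq A) (w D : nat),
      1 < size s ->
      w <= c * up_log 2 (size s) ->
      truncation_depth s w D ->
      block_graph_bits s w D <= C * (lz77_size s * trunc_log 2 (size s) ^ 2).
Proof.
move=> c; exists (32 * (1 + 6 * c)) => A s w D n_gt1 le_w truncD.
have lt_D : D < up_log 2 (size s) by rewrite -block_size_gt1; case/andP: truncD.
have le_bits : block_graph_bits s w D <= size (block_graph s D) * (1 + 6 * w).
  rewrite /block_graph_bits -sum_nat_const_seq; apply: leq_sum => u _.
  by rewrite leq_add2l stored_data_bits.
apply: leq_trans le_bits (leq_trans (leq_mul (size_block_graph lt_D) _) _).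
  apply: (_ : _ <= (1 + 6 * c) * up_log 2 (size s)).
  have : 0 < up_log 2 (size s) by apply: leq_ltn_trans lt_D.
  by nia.
have le_L := up_log2_leq_double_trunc_log n_gt1.
move: (lz77_size s) (up_log 2 (size s)) (trunc_log 2 (size s)) le_L => z L t le_L.
have -> : 8 * z * L * ((1 + 6 * c) * L) = 8 * (1 + 6 * c) * (z * L ^ 2) by lia.
have -> : 32 * (1 + 6 * c) * (z * t ^ 2) = 8 * (1 + 6 * c) * (z * (2 * t) ^ 2).
  by rewrite expnMn; lia.
by rewrite leq_mul2l leq_mul2l leq_sqr le_L !orbT.
Qed.
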